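(* For every integer $n\geq 0$ and every complex number $m\in\mathbb{C}\setminus\mathbb{Z}^{-}$ with $m\neq -3/2$, \[ \sum_{k=0}^n 2^{2k} \frac{\binom{m+k}{k}}{\binom{2k}{k}} H_{k+m} = \frac{1}{2m+3}\left ( 2^{2n+1} (m+n+1)\frac{\binom{m+n}{n}}{\binom{2n}{n}} H_{n+m} + H_m \right ) - \frac{2}{(2m+3)^2} \left (2^{2n} (2n-1)\frac{\binom{m+n}{n}}{\binom{2n}{n}} + 1\right ). \]
   Context: $\mathbb{Z}^{-}$ denotes the set of negative integers. For complex $r,s$ the generalized binomial coefficient is $\binom{r}{s}=\frac{\Gamma(r+1)}{\Gamma(s+1)\Gamma(r-s+1)}$. For $z\in\mathbb{C}\setminus\mathbb{Z}^{-}$ the harmonic number is $H_z=\psi(z+1)+\gamma$, where $\psi=\Gamma'/\Gamma$ is the digamma function and $\gamma$ the Euler–Mascheroni constant; for a non-negative integer $n$ this gives $H_n=\sum_{k=1}^n 1/k$ (with $H_0=0$). *)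

(* Defs.v *)
From Stdlib Require Export Reals Factorial.
From Coquelicot Require Export Coquelicot.

Local Open Scope R_scope.
Local Open Scope C_scope.

(** Complex exponential, e^(x+iy) = e^x (cos y + i sin y). *)
Definition Cexp (z : C) : C :=
  (exp (Re z) * cos (Im z), exp (Re z) * sin (Im z))%R.

Definition C_Lim_seq (u : nat -> C) : C :=
  (real (Lim_seq (fun n => Re (u n))), real (Lim_seq (fun n => Im (u n)))).

(** z (z+1) ... (z+n-1) *)
Fixpoint rising (z : C) (n : nat) : C :=
  match n with
  | O => 1
  | S k => rising z k * (z + INR k)
  end.

(** Gauss's (Euler's) limit, valid on the whole domain of the Gamma function:
    Gamma z = lim_n n! n^z / (z (z+1) ... (z+n)), with n^z = e^(z log n).
    Only meaningful when z is not in {0, -1, -2, ...}. *)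
Definition Gamma (z : C) : C :=
  C_Lim_seq (fun n =>
    RtoC (INR (fact n)) * Cexp (z * RtoC (ln (INR n))) / rising z (S n)).

(** [C_derive f z] is the complex derivative of [f] whenever it exists
    ([is_C_derive_unique]). *)
Definition digamma (z : C) : C := C_derive Gamma z / Gamma z.

Definition euler_gamma : R :=
  real (Lim_seq (fun n => sum_n_m (fun k => / INR k) 1 n - ln (INR n))%R).

(** Only meaningful when none of r+1, s+1, r-s+1 is a pole of Gamma. *)
Definition Cbinom (r s : C) : C :=
  Gamma (r + 1) / (Gamma (s + 1) * Gamma (r - s + 1)).

(** Only meaningful when z is not a negative integer. *)
Definition harmonic (z : C) : C := digamma (z + 1) + euler_gamma.

(* Main.v *)
Require Import Defs.
From Stdlib Require Import Reals ZArith Lra Lia.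
From Coquelicot Require Import Coquelicot.

Local Open Scope R_scope.

(** The summand is [b_k H_{k+m}] with [b_{k+1} = 2 (m+k+1) / (2k+1) b_k] and
    [H_{k+1+m} = H_{k+m} + 1/(k+1+m)], so the identity follows by induction on [n]. Both
    recurrences reduce to [Gamma (z+1) = z Gamma z] and [Gamma z <> 0], together with the
    existence of the derivative of [Gamma] off the poles.

    For [Re z > 0], Euler's limit is [Cexp (P z) / z] with
    [P z = sum_p (z ln (1 + 1/p) - Log (1 + z/p))]; this series and its derivative are
    dominated by a multiple of [sum_p 1/p^2] on bounded sets, so [Gamma] exists, does not
    vanish and is differentiable there. The identity
    [Gamma_n z = Gamma_n (z+1) (z+n+1) / (n z)] between the approximants carries all of
    this one unit to the left, hence to every [z] that is not a pole. *)

(** * Series of real functions: summable majorants and termwise differentiation *)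

Lemma is_lim_seq_inv_INR : is_lim_seq (fun n => / INR n)%R 0.
Proof.
  replace (Finite 0) with (Rbar_inv p_infty) by reflexivity.
  apply is_lim_seq_inv; [apply is_lim_seq_INR | discriminate].
Qed.

(** Comparison with a telescoping series: [1 / p^2 <= 2 (1/p - 1/(p+1))], because [p + 1 <= 2 p] for
    [p >= 1]. *)
Lemma ex_series_inv_sqr : ex_series (fun n => / INR (S n) ^ 2).
Proof.
  assert (Hp : forall n, 0 < INR (S n)) by (intro; apply lt_0_INR; lia).
  apply ex_series_Rabs.
  apply (ex_series_le (V := R_CompleteNormedModule) _
           (fun n => 2 * (/ INR (S n) - / INR (S (S n))))).
  - intro n. change (Rabs (Rabs (/ INR (S n) ^ 2)) <= 2 * (/ INR (S n) - / INR (S (S n)))).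
    rewrite Rabs_Rabsolu, Rabs_pos_eq.
    2: left; apply Rinv_0_lt_compat, pow_lt, Hp.
    assert (H1 : 1 <= INR (S n)) by (rewrite S_INR; pose proof (pos_INR n); lra).
    rewrite (S_INR (S n)). set (p := INR (S n)) in *.
    apply Rmult_le_reg_r with (p ^ 2 * (p + 1)). { nra. }
    field_simplify; nra.
  - exists 2.
    change (is_lim_seq (sum_n (fun n => 2 * (/ INR (S n) - / INR (S (S n))))) 2).
    apply is_lim_seq_ext with (fun n => 2 * (1 - / INR (S (S n)))).
    + intro n. induction n as [|n IH].
      * rewrite sum_O. simpl. field.
      * rewrite sum_Sn, <- IH. change plus with Rplus. simpl INR. ring.
    + replace (Finite 2) with (Finite (2 * (1 - 0))) by (f_equal; ring).
      apply is_lim_seq_mult'; [apply is_lim_seq_const|].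
      apply is_lim_seq_minus'; [apply is_lim_seq_const|].
      apply (is_lim_seq_incr_1 (fun n => / INR (S n))), (is_lim_seq_incr_1 (fun n => / INR n)).
      apply is_lim_seq_inv_INR.
Qed.

(** Weierstrass M-test: the blocks of the function series are bounded by the blocks of [M], so the
    uniform Cauchy criterion applies. *)
Lemma CVU_dom_sum_n (f : nat -> R -> R) (M : nat -> R) (D : R -> Prop) :
  (forall n x, D x -> Rabs (f n x) <= M n) -> ex_series M ->
  CVU_dom (fun n x => sum_n (fun k => f k x) n) D.
Proof.
  intros Hf HM. apply CVU_dom_cauchy. intro eps.
  destruct (Cauchy_ex_series (V := R_CompleteNormedModule) M HM eps) as [N HN]. exists N.
  assert (H : forall n m x, D x -> (N <= n)%nat -> (n < m)%nat ->
    Rabs (sum_n (fun k => f k x) n - sum_n (fun k => f k x) m) < eps).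
  { intros n m x Hx Hn Hm.
    rewrite Rabs_minus_sym.
    change (sum_n (fun k => f k x) m - sum_n (fun k => f k x) n)
      with (minus (G := R_AbelianGroup) (sum_n (fun k => f k x) m) (sum_n (fun k => f k x) n)).
    rewrite <- (sum_n_m_sum_n (G := R_AbelianGroup)) by lia.
    eapply Rle_lt_trans; [| apply (HN (S n) m); lia].
    eapply Rle_trans; [apply (norm_sum_n_m (V := R_NormedModule))|].
    eapply Rle_trans; [apply sum_n_m_le with (b := M) | apply Rle_abs].
    intro k. apply (Hf k x Hx). }
  intros n m x Hx Hn Hm.
  destruct (Nat.lt_trichotomy n m) as [L|[->|L]].
  - now apply H.
  - rewrite Rminus_diag, Rabs_R0. apply cond_pos.
  - rewrite Rabs_minus_sym. now apply H.
Qed.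

(** One majorant [M] serves both the terms and their derivatives, so both partial sums converge
    uniformly on [D]. Only existence of the derivative is kept: the recurrence for the digamma
    function never uses its value. *)
Lemma is_derive_Series (f df : nat -> R -> R) (M : nat -> R) (D : R -> Prop) :
  open D -> is_connected D -> ex_series M ->
  (forall n x, D x -> Rabs (f n x) <= M n) ->
  (forall n x, D x -> Rabs (df n x) <= M n) ->
  (forall n x, D x -> is_derive (f n) x (df n x)) ->
  (forall n x, D x -> continuous (df n) x) ->
  forall x, D x -> ex_derive (fun y => Series (fun k => f k y)) x.
Proof.
  intros HD HC HM Hf Hdf Hd Hc x Hx.
  assert (Hs : forall n y, D y ->
    is_derive (fun y => sum_n (fun k => f k y) n) y (sum_n (fun k => df k y) n)).
  { intros n y Hy. apply (is_derive_sum_n (K := R_AbsRing) (V := R_NormedModule)).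
    intros k _. now apply Hd. }
  eexists. apply (CVU_Derive (fun n y => sum_n (fun k => f k y) n) D); auto.
  - now apply CVU_dom_sum_n with M.
  - intros n y Hy. eexists. now apply Hs.
  - intros n y Hy. apply continuity_pt_filterlim.
    apply (continuous_ext_loc _ (fun y => sum_n (fun k => df k y) n)).
    + apply filter_imp with D; [| now apply HD].
      intros z Hz. symmetry. apply is_derive_unique. now apply Hs.
    + induction n as [|n IH].
      * apply (continuous_ext (df O)); [intro; now rewrite sum_O | now apply Hc].
      * apply (continuous_ext (fun y => plus (sum_n (fun k => df k y) n) (df (S n) y)));
          [intro; now rewrite sum_Sn |].
        apply (continuous_plus (K := R_AbsRing) (V := R_NormedModule)); [apply IH | now apply Hc].
  - intro eps. destruct (CVU_dom_sum_n df M D Hdf HM eps) as [N HN].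
    exists N. intros n Hn y Hy.
    assert (E : forall k, Derive (fun y => sum_n (fun k => f k y) k) y = sum_n (fun k => df k y) k)
      by (intro; now apply is_derive_unique, Hs).
    rewrite E, (Lim_seq_ext _ _ E). now apply HN.
Qed.

(** * Bounds of order 1/p^2 on the logarithms of Euler's factors *)

(** [dlog_term p y t] is the common value, by Cauchy-Riemann, of the [t]-derivative
    of [log_term_re] and the [y]-derivative of [log_term_im]. *)
Definition dlog_term (p y t : R) : R :=
  ln (p + 1) - ln p - (p + t) / ((p + t) ^ 2 + y ^ 2).

(** Real and imaginary parts of [z ln (1 + 1/p) - Log (1 + z/p)] at [z = t + iy],
    the logarithm of the [p]-th factor of Euler's product for [z Gamma z]. *)
Definition log_term_re (p y t : R) : R :=
  t * (ln (p + 1) - ln p) - / 2 * ln ((p + t) ^ 2 + y ^ 2) + ln p.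

Definition log_term_im (p y t : R) : R :=
  y * (ln (p + 1) - ln p) - atan (y / (p + t)).

Lemma ln_le_sub_one (x : R) : 0 < x -> ln x <= x - 1.
Proof.
  intro Hx. pose proof (exp_ineq1_le (ln x)). rewrite exp_ln in H by easy. lra.
Qed.

Lemma ln_succ_bounds (p : R) : 0 < p -> / (p + 1) <= ln (p + 1) - ln p <= / p.
Proof.
  intro Hp. rewrite <- ln_div by lra. split.
  - assert (H := ln_le_sub_one (p / (p + 1)) ltac:(apply Rdiv_lt_0_compat; lra)).
    rewrite ln_div in H |- * by lra.
    replace (p / (p + 1) - 1) with (- / (p + 1)) in H by (field; lra). lra.
  - assert (H := ln_le_sub_one ((p + 1) / p) ltac:(apply Rdiv_lt_0_compat; lra)).
    replace ((p + 1) / p - 1) with (/ p) in H by (field; lra). lra.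
Qed.

(** Both parts of the difference are close to [1/p] from below: the logarithmic one lies in
    [[1/p - 1/p^2, 1/p]], the fraction in [[1/p - (t + y^2)/p^2, 1/p]]. *)
Lemma dlog_term_bound (p y t : R) : 1 <= p -> 0 <= t ->
  Rabs (dlog_term p y t) <= (1 + t + y ^ 2) * / p ^ 2.
Proof.
  intros Hp Ht. unfold dlog_term.
  pose proof (ln_succ_bounds p ltac:(lra)) as [H1 H2].
  assert (Hq : 0 < (p + t) ^ 2 + y ^ 2) by nra.
  assert (A1 : / p - / p ^ 2 <= / (p + 1)).
  { apply Rmult_le_reg_r with (p ^ 2 * (p + 1)); [nra|].
    replace (/ (p + 1) * (p ^ 2 * (p + 1))) with (p ^ 2) by (field; lra).
    replace ((/ p - / p ^ 2) * (p ^ 2 * (p + 1))) with (p ^ 2 - 1) by (field; lra). lra. }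
  assert (A2 : / p - (t + y ^ 2) * / p ^ 2 <= (p + t) / ((p + t) ^ 2 + y ^ 2)).
  { apply Rmult_le_reg_r with (p ^ 2 * ((p + t) ^ 2 + y ^ 2)); [apply Rmult_lt_0_compat; nra|].
    replace ((p + t) / ((p + t) ^ 2 + y ^ 2) * (p ^ 2 * ((p + t) ^ 2 + y ^ 2)))
      with ((p + t) * p ^ 2) by (field; lra).
    replace ((/ p - (t + y ^ 2) * / p ^ 2) * (p ^ 2 * ((p + t) ^ 2 + y ^ 2)))
      with ((p - t - y ^ 2) * ((p + t) ^ 2 + y ^ 2)) by (field; lra).
    assert (0 <= y ^ 2) by nra. set (s := y ^ 2) in *.
    (* The right side minus the left is [t^2 (p+t) + s ((p+t)^2 - p) + s t + s^2], a sum of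
       nonnegative terms. *)
    assert (0 <= t ^ 2 * (p + t)) by (apply Rmult_le_pos; nra).
    assert (0 <= s * t) by nra.
    assert (0 <= s * ((p + t) ^ 2 - p)) by (apply Rmult_le_pos; nra).
    nra. }
  assert (A3 : (p + t) / ((p + t) ^ 2 + y ^ 2) <= / p).
  { apply Rmult_le_reg_r with (p * ((p + t) ^ 2 + y ^ 2)); [apply Rmult_lt_0_compat; nra|].
    replace ((p + t) / ((p + t) ^ 2 + y ^ 2) * (p * ((p + t) ^ 2 + y ^ 2)))
      with ((p + t) * p) by (field; lra).
    replace (/ p * (p * ((p + t) ^ 2 + y ^ 2)))
      with ((p + t) ^ 2 + y ^ 2) by (field; lra). nra. }
  assert (0 < / p ^ 2) by (apply Rinv_0_lt_compat; nra).
  assert (0 <= (t + y ^ 2) * / p ^ 2) by (apply Rmult_le_pos; nra).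
  apply Rabs_le. lra.
Qed.

Lemma is_derive_log_term_re (p y t : R) : 0 < p + t ->
  is_derive (log_term_re p y) t (dlog_term p y t).
Proof.
  intro H. unfold log_term_re, dlog_term. assert (0 < (p + t) ^ 2 + y ^ 2) by nra.
  auto_derive; [nra |]. field. nra.
Qed.

Lemma is_derive_log_term_im (p y t : R) : 0 < p + t ->
  is_derive (log_term_im p y) t (y / ((p + t) ^ 2 + y ^ 2)).
Proof.
  intro H. unfold log_term_im. assert (0 < (p + t) ^ 2 + y ^ 2) by nra.
  auto_derive; [lra |]. field. split; nra.
Qed.

Lemma is_derive_log_term_im_y (p y t : R) : 0 < p + t ->
  is_derive (fun y => log_term_im p y t) y (dlog_term p y t).
Proof.
  intro H. unfold log_term_im, dlog_term. assert (0 < (p + t) ^ 2 + y ^ 2) by nra.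
  auto_derive; [lra |]. field. split; nra.
Qed.

(** At [t = 0] the term is [- 1/2 ln (1 + y^2/p^2)], of size at most [y^2/p^2]; the mean value
    theorem in [t] controls the rest through [dlog_term]. *)
Lemma log_term_re_bound (p y t : R) : 1 <= p -> 0 <= t ->
  Rabs (log_term_re p y t) <= (y ^ 2 + (1 + t + y ^ 2) * t) * / p ^ 2.
Proof.
  intros Hp Ht.
  assert (P2 : 0 < / p ^ 2) by (apply Rinv_0_lt_compat; nra).
  assert (H0 : Rabs (log_term_re p y 0) <= y ^ 2 * / p ^ 2).
  { unfold log_term_re.
    assert (0 < (1 + y ^ 2 * / p ^ 2)) by nra.
    replace ((p + 0) ^ 2 + y ^ 2) with (p * p * (1 + y ^ 2 * / p ^ 2)) by (field; lra).
    rewrite !ln_mult by nra.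
    pose proof (ln_le_sub_one (1 + y ^ 2 * / p ^ 2) ltac:(easy)).
    assert (0 <= ln (1 + y ^ 2 * / p ^ 2)) by (rewrite <- ln_1; apply ln_le; nra).
    apply Rabs_le. lra. }
  destruct (MVT_abs (log_term_re p y) (dlog_term p y) 0 t) as [c [Hc1 Hc2]].
  { intros c Hc. apply is_derive_Reals, is_derive_log_term_re.
    rewrite Rmin_left in Hc by lra. lra. }
  rewrite Rmin_left, Rmax_right in Hc2 by lra.
  pose proof (dlog_term_bound p y c Hp ltac:(lra)) as Hb.
  rewrite Rminus_0_r, (Rabs_pos_eq t) in Hc1 by easy.
  assert (Rabs (dlog_term p y c) * t <= (1 + t + y ^ 2) * / p ^ 2 * t).
  { apply Rmult_le_compat_r; [easy|]. eapply Rle_trans; [apply Hb|].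
    apply Rmult_le_compat_r; lra. }
  replace (log_term_re p y t) with
    (log_term_re p y 0 + (log_term_re p y t - log_term_re p y 0)) by ring.
  eapply Rle_trans; [apply Rabs_triang|]. lra.
Qed.

(** The term vanishes at [y = 0] and its [y]-derivative is again [dlog_term], so the mean value
    theorem in [y] suffices. *)
Lemma log_term_im_bound (p y t : R) : 1 <= p -> 0 <= t ->
  Rabs (log_term_im p y t) <= (1 + t + y ^ 2) * Rabs y * / p ^ 2.
Proof.
  intros Hp Ht.
  assert (P2 : 0 < / p ^ 2) by (apply Rinv_0_lt_compat; nra).
  destruct (MVT_abs (fun y => log_term_im p y t) (fun y => dlog_term p y t) 0 y) as [c [Hc1 Hc2]].
  { intros c _. apply is_derive_Reals, is_derive_log_term_im_y. lra. }
  replace (log_term_im p 0 t) with 0 in Hc1.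
  2: { unfold log_term_im, Rdiv. rewrite !Rmult_0_l, atan_0. ring. }
  rewrite !Rminus_0_r in Hc1. rewrite Hc1.
  assert (c ^ 2 <= y ^ 2).
  { unfold Rmin, Rmax in Hc2. destruct (Rle_dec 0 y); nra. }
  pose proof (dlog_term_bound p c t Hp Ht) as Hb.
  replace ((1 + t + y ^ 2) * Rabs y * / p ^ 2) with ((1 + t + y ^ 2) * / p ^ 2 * Rabs y) by ring.
  apply Rmult_le_compat_r; [apply Rabs_pos|].
  eapply Rle_trans; [apply Hb|]. apply Rmult_le_compat_r; lra.
Qed.

Lemma dlog_term_im_bound (p y t : R) : 1 <= p -> 0 <= t ->
  Rabs (y / ((p + t) ^ 2 + y ^ 2)) <= Rabs y * / p ^ 2.
Proof.
  intros Hp Ht. assert (0 < (p + t) ^ 2 + y ^ 2) by nra.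
  unfold Rdiv. rewrite Rabs_mult. apply Rmult_le_compat_l; [apply Rabs_pos|].
  rewrite Rabs_pos_eq by (left; now apply Rinv_0_lt_compat).
  apply Rinv_le_contravar; nra.
Qed.

Lemma INR_S_ge_1 (k : nat) : 1 <= INR (S k).
Proof. rewrite S_INR. pose proof (pos_INR k). lra. Qed.

(** The majorant is uniform in [t] but may depend on [y], since differentiation takes place only
    along a horizontal line. *)
Lemma log_terms_dominated (y B : R) : 0 <= B ->
  exists M, ex_series M /\ forall k t, 0 < t < B ->
    Rabs (log_term_re (INR (S k)) y t) <= M k /\
    Rabs (log_term_im (INR (S k)) y t) <= M k /\
    Rabs (dlog_term (INR (S k)) y t) <= M k /\
    Rabs (y / ((INR (S k) + t) ^ 2 + y ^ 2)) <= M k.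
Proof.
  intros HB.
  exists (fun k => (y ^ 2 + (1 + B + y ^ 2) * (1 + B + Rabs y)) * / INR (S k) ^ 2).
  split; [apply (ex_series_scal (K := R_AbsRing) (V := R_NormedModule)), ex_series_inv_sqr|].
  intros k t Ht. pose proof (INR_S_ge_1 k) as Hp. set (p := INR (S k)) in *.
  assert (P2 : 0 < / p ^ 2) by (apply Rinv_0_lt_compat; nra).
  pose proof (Rabs_pos y) as Hy.
  assert (Ht' : 0 <= t) by lra.
  pose proof (log_term_re_bound p y t Hp Ht') as H1.
  pose proof (log_term_im_bound p y t Hp Ht') as H2.
  pose proof (dlog_term_bound p y t Hp Ht') as H3.
  pose proof (dlog_term_im_bound p y t Hp Ht') as H4.
  assert (0 <= y ^ 2) by nra.
  assert (0 <= (1 + B + y ^ 2) * Rabs y) by (apply Rmult_le_pos; lra).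
  repeat split; (eapply Rle_trans; [eassumption|]; apply Rmult_le_compat_r; [lra|]).
  - nra.
  - nra.
  - nra.
  - nra.
Qed.

Definition log_sum_re (y t : R) : R := Series (fun k => log_term_re (INR (S k)) y t).
Definition log_sum_im (y t : R) : R := Series (fun k => log_term_im (INR (S k)) y t).

Lemma log_sums_correct (y t : R) : 0 < t ->
  is_series (fun k => log_term_re (INR (S k)) y t) (log_sum_re y t) /\
  is_series (fun k => log_term_im (INR (S k)) y t) (log_sum_im y t).
Proof.
  intro Ht. destruct (log_terms_dominated y (t + 1)) as [M [HM H]]; [lra|].
  split; apply Series_correct;
    apply (ex_series_le (V := R_CompleteNormedModule) _ M); trivial;
    intro k; apply (H k t); lra.
Qed.

Lemma log_sums_derivable (y t : R) : 0 < t ->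
  ex_derive (log_sum_re y) t /\ ex_derive (log_sum_im y) t.
Proof.
  intro Ht. destruct (log_terms_dominated y (t + 1)) as [M [HM H]]; [lra|].
  (* The bound [t + 1] makes [t] an interior point of a bounded interval. *)
  set (D := fun x => 0 < x < t + 1).
  assert (HD : open D) by (apply open_and; [apply open_gt | apply open_lt]).
  assert (HC : is_connected D) by (unfold D; intros a b x; lra).
  assert (Hp : forall k x, D x -> 0 < INR (S k) + x).
  { unfold D. intros k x Hx. pose proof (INR_S_ge_1 k). lra. }
  split.
  - apply (is_derive_Series (fun k => log_term_re (INR (S k)) y)
             (fun k => dlog_term (INR (S k)) y) M D); trivial.
    + intros; now apply H.
    + intros; now apply H.
    + intros; apply is_derive_log_term_re; auto.
    + intros n x Hx. apply (ex_derive_continuous (K := R_AbsRing) (V := R_NormedModule)).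
      specialize (Hp n x Hx). unfold dlog_term. generalize dependent (INR (S n)).
      intros p Hp. auto_derive. nra.
    + unfold D; lra.
  - apply (is_derive_Series (fun k => log_term_im (INR (S k)) y)
             (fun k t => y / ((INR (S k) + t) ^ 2 + y ^ 2)) M D); trivial.
    + intros; now apply H.
    + intros; now apply H.
    + intros; apply is_derive_log_term_im; auto.
    + intros n x Hx. apply (ex_derive_continuous (K := R_AbsRing) (V := R_NormedModule)).
      specialize (Hp n x Hx). generalize dependent (INR (S n)).
      intros p Hp. auto_derive. nra.
    + unfold D; lra.
Qed.

Local Open Scope C_scope.

(** * The complex exponential and the factors of Euler's product *)

Lemma Cexp_plus (z w : C) : Cexp (z + w) = Cexp z * Cexp w.
Proof.
  unfold Cexp, Re, Im, Cmult. simpl.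
  rewrite exp_plus, cos_plus, sin_plus. f_equal; ring.
Qed.

Lemma Cexp_RtoC (x : R) : Cexp (RtoC x) = RtoC (exp x).
Proof.
  unfold Cexp, RtoC, Re, Im; cbn [fst snd]. rewrite cos_0, sin_0. f_equal; ring.
Qed.

Lemma Cexp_0 : Cexp 0 = 1.
Proof. now rewrite Cexp_RtoC, exp_0. Qed.

Lemma Cexp_neq_0 (z : C) : Cexp z <> 0.
Proof.
  intro H. apply C1_nz. rewrite <- Cexp_0.
  replace (RtoC 0) with (z + - z) by ring.
  rewrite Cexp_plus, H. ring.
Qed.

(** The exponent is the principal logarithm of [u + iv]; for [u > 0] the argument is [atan (v / u)]
    and the modulus is [u * sqrt (1 + (v/u)^2)], whose root cancels against those of [cos_atan] and
    [sin_atan]. *)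
Lemma Cexp_polar (u v : R) : (0 < u)%R ->
  Cexp ((/ 2 * ln (u ^ 2 + v ^ 2))%R, atan (v / u)) = (u, v).
Proof.
  intro Hu. unfold Cexp, Re, Im; cbn [fst snd].
  assert (Hs : (0 < 1 + (v / u)²)%R) by (pose proof (Rle_0_sqr (v / u)); lra).
  assert (E : (exp (/ 2 * ln (u ^ 2 + v ^ 2)) = u * sqrt (1 + (v / u)²))%R).
  { replace (u ^ 2 + v ^ 2)%R with (u * u * (1 + (v / u)²))%R by (unfold Rsqr; field; lra).
    rewrite <- (sqrt_sqrt (1 + (v / u)²)) at 1 by lra.
    set (q := sqrt (1 + (v / u)²)). assert (0 < q)%R by now apply sqrt_lt_R0.
    rewrite !ln_mult by nra.
    replace (/ 2 * (ln u + ln u + (ln q + ln q)))%R with (ln u + ln q)%R by field.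
    rewrite exp_plus, !exp_ln by easy. reflexivity. }
  rewrite E, cos_atan, sin_atan.
  assert (0 < sqrt (1 + (v / u)²))%R by now apply sqrt_lt_R0.
  f_equal; field; lra.
Qed.

Lemma RtoC_neq_0 (x : R) : (x <> 0)%R -> RtoC x <> 0.
Proof. intros H E. apply H. now injection E. Qed.

Lemma Cpair_decomp (z : C) : z = (Re z, Im z).
Proof. now destruct z. Qed.

(** This is [(1 + 1/p)^z = (1 + z/p) exp (term)] multiplied by [p], stated without a complex
    logarithm. *)
Lemma Cexp_log_term (p : R) (z : C) : (0 < p)%R -> (0 < p + Re z)%R ->
  Cexp (z * RtoC (ln (p + 1) - ln p)) * p =
  (z + p) * Cexp (log_term_re p (Im z) (Re z), log_term_im p (Im z) (Re z)).
Proof.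
  intros Hp Hz. destruct z as [t y]; simpl Re in *; simpl Im.
  rewrite <- (exp_ln p) at 3 by easy.
  rewrite <- Cexp_RtoC.
  replace ((t, y) + p) with ((p + t, y)%R).
  2: { unfold RtoC, Cplus; simpl. f_equal; ring. }
  rewrite <- (Cexp_polar (p + t) y) by easy. rewrite <- !Cexp_plus. f_equal.
  unfold log_term_re, log_term_im, RtoC, Cplus, Cmult; simpl. f_equal; ring.
Qed.

Lemma rising_S_l (z : C) (n : nat) : rising z (S n) = z * rising (z + 1) n.
Proof.
  induction n as [|n IH].
  - simpl. ring.
  - change (rising z (S (S n))) with (rising z (S n) * (z + INR (S n))).
    rewrite IH. change (rising (z + 1) (S n)) with (rising (z + 1) n * (z + 1 + INR n)).
    rewrite S_INR, RtoC_plus. ring.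
Qed.

Lemma Re_plus_INR_neq_0 (z : C) (k : nat) : (0 < Re z)%R -> z + INR k <> 0.
Proof.
  intros Hz H. apply (f_equal Re) in H. simpl in H. pose proof (pos_INR k). unfold Re in *. lra.
Qed.

Lemma rising_neq_0 (z : C) (n : nat) : (forall k, z + INR k <> 0) -> rising z n <> 0.
Proof.
  intro Hz. induction n as [|n IH]; simpl.
  - apply C1_nz.
  - now apply Cmult_neq_0.
Qed.

(** Product of [Cexp_log_term] over [p = 1, ..., n+1]: the factors [(p+1)/p] telescope, which leaves
    the power [(n+2)^z] beside [(n+1)!]. *)
Lemma Euler_product_partial (z : C) (n : nat) : (0 < Re z)%R ->
  RtoC (INR (fact (S n))) * Cexp (z * RtoC (ln (INR (S (S n))))) =
  rising (z + 1) (S n) *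
  Cexp (sum_n (fun k => log_term_re (INR (S k)) (Im z) (Re z)) n,
        sum_n (fun k => log_term_im (INR (S k)) (Im z) (Re z)) n).
Proof.
  intro Hz.
  assert (Hstep : forall k, RtoC (INR (S k)) * Cexp (z * RtoC (ln (INR (S (S k))))) =
     (z + 1 + INR k) * Cexp (z * RtoC (ln (INR (S k)))) *
      Cexp (log_term_re (INR (S k)) (Im z) (Re z), log_term_im (INR (S k)) (Im z) (Re z))).
  { intro k. pose proof (INR_S_ge_1 k) as Hk.
    pose proof (Cexp_log_term (INR (S k)) z ltac:(lra) ltac:(lra)) as H.
    rewrite <- S_INR in H.
    replace (z * RtoC (ln (INR (S (S k))))) with
      (z * RtoC (ln (INR (S (S k))) - ln (INR (S k))) + z * RtoC (ln (INR (S k))))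
      by (rewrite RtoC_minus; ring).
    rewrite Cexp_plus.
    replace (z + 1 + INR k) with (z + INR (S k)) by (rewrite S_INR, RtoC_plus; ring).
    transitivity (Cexp (z * RtoC (ln (INR (S (S k))) - ln (INR (S k)))) * INR (S k)
      * Cexp (z * RtoC (ln (INR (S k))))); [ring|]. rewrite H. ring. }
  induction n as [|n IH].
  - change (fact 1) with 1%nat. rewrite !sum_O, (Hstep O). simpl INR. rewrite ln_1, Cmult_0_r, Cexp_0. simpl. ring.
  - rewrite !sum_Sn.
    change (fact (S (S n))) with (S (S n) * fact (S n))%nat.
    rewrite mult_INR, RtoC_mult.
    transitivity (RtoC (INR (fact (S n))) *
      (RtoC (INR (S (S n))) * Cexp (z * RtoC (ln (INR (S (S (S n)))))))); [ring|].
    rewrite Hstep.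
    transitivity ((z + 1 + INR (S n)) *
      Cexp (log_term_re (INR (S (S n))) (Im z) (Re z), log_term_im (INR (S (S n))) (Im z) (Re z)) *
      (RtoC (INR (fact (S n))) * Cexp (z * RtoC (ln (INR (S (S n))))))); [ring|].
    rewrite IH.
    change (rising (z + 1) (S (S n))) with (rising (z + 1) (S n) * (z + 1 + INR (S n))).
    match goal with |- _ = _ * Cexp (plus ?a ?b, plus ?c ?d) =>
      change (plus a b, plus c d) with ((a, c) + (b, d)) end.
    rewrite Cexp_plus. ring.
Qed.

(** * Limits of complex sequences, coordinate by coordinate *)

Definition is_Clim_seq (u : nat -> C) (l : C) : Prop :=
  is_lim_seq (fun n => Re (u n)) (Re l) /\ is_lim_seq (fun n => Im (u n)) (Im l).

Lemma is_Clim_seq_unique (u : nat -> C) (l : C) : is_Clim_seq u l -> C_Lim_seq u = l.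
Proof.
  intros [H1 H2]. unfold C_Lim_seq.
  rewrite (is_lim_seq_unique _ _ H1), (is_lim_seq_unique _ _ H2). now destruct l.
Qed.

Lemma is_Clim_seq_ext_loc (u v : nat -> C) (l : C) :
  eventually (fun n => u n = v n) -> is_Clim_seq u l -> is_Clim_seq v l.
Proof.
  intros H [H1 H2]. split.
  - apply (is_lim_seq_ext_loc (fun n => Re (u n))); trivial.
    revert H. apply filter_imp. now intros n ->.
  - apply (is_lim_seq_ext_loc (fun n => Im (u n))); trivial.
    revert H. apply filter_imp. now intros n ->.
Qed.

Lemma is_Clim_seq_incr_1 (u : nat -> C) (l : C) :
  is_Clim_seq (fun n => u (S n)) l -> is_Clim_seq u l.
Proof. intros [H1 H2]. split; now apply is_lim_seq_incr_1. Qed.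

Lemma is_Clim_seq_const (c : C) : is_Clim_seq (fun _ => c) c.
Proof. split; apply is_lim_seq_const. Qed.

Lemma is_Clim_seq_plus (u v : nat -> C) (a b : C) :
  is_Clim_seq u a -> is_Clim_seq v b -> is_Clim_seq (fun n => u n + v n) (a + b).
Proof. intros [H1 H2] [H3 H4]. split; now apply is_lim_seq_plus'. Qed.

Lemma is_Clim_seq_mult (u v : nat -> C) (a b : C) :
  is_Clim_seq u a -> is_Clim_seq v b -> is_Clim_seq (fun n => u n * v n) (a * b).
Proof.
  intros [H1 H2] [H3 H4]. split.
  - apply is_lim_seq_minus'; now apply is_lim_seq_mult'.
  - apply is_lim_seq_plus'; now apply is_lim_seq_mult'.
Qed.

Lemma is_Clim_seq_RtoC (u : nat -> R) (l : R) :
  is_lim_seq u l -> is_Clim_seq (fun n => RtoC (u n)) l.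
Proof. intro H. split; [exact H | apply is_lim_seq_const]. Qed.

Lemma is_Clim_seq_Cexp (u : nat -> C) (l : C) :
  is_Clim_seq u l -> is_Clim_seq (fun n => Cexp (u n)) (Cexp l).
Proof.
  intros [H1 H2].
  assert (E : is_lim_seq (fun n => exp (Re (u n))) (exp (Re l))).
  { apply (is_lim_seq_continuous exp); trivial. apply derivable_continuous_pt, derivable_pt_exp. }
  split; simpl; apply is_lim_seq_mult'; trivial.
  - apply (is_lim_seq_continuous cos); trivial. apply continuity_cos.
  - apply (is_lim_seq_continuous sin); trivial. apply continuity_sin.
Qed.

(** Euler's approximant of index [n+1] contains [(n+1)^z], whereas the partial product yields
    [(n+2)^z]; this limit makes their quotient tend to 1. *)
Lemma is_lim_seq_ln_succ : is_lim_seq (fun n => ln (INR (S n)) - ln (INR (S (S n))))%R 0.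
Proof.
  assert (H := proj1 (is_lim_seq_incr_1 _ _) is_lim_seq_inv_INR).
  apply is_lim_seq_le_le with (fun n => - / INR (S n))%R (fun _ => 0%R).
  - intro n. pose proof (INR_S_ge_1 n).
    rewrite (S_INR (S n)). pose proof (ln_succ_bounds (INR (S n)) ltac:(lra)).
    assert (0 < / (INR (S n) + 1))%R by (apply Rinv_0_lt_compat; lra). lra.
  - replace (Finite 0) with (Rbar_opp 0) by (simpl; f_equal; ring).
    now apply -> is_lim_seq_opp.
  - apply is_lim_seq_const.
Qed.

(** * Convergence and non-vanishing of Euler's limit *)

Definition Gamma_seq (z : C) (n : nat) : C :=
  RtoC (INR (fact n)) * Cexp (z * RtoC (ln (INR n))) / rising z (S n).

(** [C_Lim_seq] returns a value even for a divergent sequence, so genuine convergence has to be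
    carried along with the value of [Gamma]. *)
Definition Gamma_converges (z : C) : Prop :=
  (forall k, z + INR k <> 0) /\ is_Clim_seq (Gamma_seq z) (Gamma z) /\ Gamma z <> 0.

Lemma Gamma_converges_intro (z l : C) : (forall k, z + INR k <> 0) ->
  is_Clim_seq (Gamma_seq z) l -> l <> 0 -> Gamma_converges z /\ Gamma z = l.
Proof.
  intros Hk H Hl. assert (E : Gamma z = l) by now apply is_Clim_seq_unique.
  unfold Gamma_converges. rewrite E. auto.
Qed.

Lemma Cdiv_neq_0 (a b : C) : a <> 0 -> b <> 0 -> a / b <> 0.
Proof.
  intros Ha Hb H. apply Ha. replace a with (a / b * b) by (field; easy). rewrite H. ring.
Qed.

(** The approximant of index [n+1] equals the exponential of the partial log sums, times the
    correction from [n+2] to [n+1], divided by [z]. An exponential has no zero, hence neither has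
    the limit. *)
Lemma Gamma_Re_pos (z : C) : (0 < Re z)%R ->
  Gamma_converges z /\
  Gamma z = Cexp (log_sum_re (Im z) (Re z), log_sum_im (Im z) (Re z)) / z.
Proof.
  intro Hz.
  assert (Hk := fun k => Re_plus_INR_neq_0 z k Hz).
  assert (Hz0 : z <> 0) by (intro H; apply (Hk O); rewrite H; simpl; ring).
  apply Gamma_converges_intro; [easy| |].
  2: apply Cdiv_neq_0; [apply Cexp_neq_0 | easy].
  apply is_Clim_seq_incr_1.
  set (s := fun n => (sum_n (fun k => log_term_re (INR (S k)) (Im z) (Re z)) n,
                      sum_n (fun k => log_term_im (INR (S k)) (Im z) (Re z)) n) : C).
  apply is_Clim_seq_ext_loc with
    (fun n => Cexp (s n) * Cexp (z * RtoC (ln (INR (S n)) - ln (INR (S (S n))))) * / z).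
  - exists O. intros n _. unfold Gamma_seq.
    replace (z * RtoC (ln (INR (S n)))) with
      (z * RtoC (ln (INR (S (S n)))) + z * RtoC (ln (INR (S n)) - ln (INR (S (S n)))))
      by (rewrite RtoC_minus; ring).
    rewrite Cexp_plus, Cmult_assoc, Euler_product_partial by easy.
    rewrite (rising_S_l z (S n)). fold (s n). field. split; [|easy].
    apply rising_neq_0. intros k H. apply (Hk (S k)). rewrite S_INR, RtoC_plus, <- H. ring.
  - replace (Cexp (log_sum_re (Im z) (Re z), log_sum_im (Im z) (Re z)) / z) with
      (Cexp (log_sum_re (Im z) (Re z), log_sum_im (Im z) (Re z)) * Cexp (z * RtoC 0) * / z)
      by (rewrite Cmult_0_r, Cexp_0; unfold Cdiv; ring).
    repeat apply is_Clim_seq_mult.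
    + apply is_Clim_seq_Cexp.
      destruct (log_sums_correct (Im z) (Re z) Hz). split; assumption.
    + apply is_Clim_seq_Cexp, is_Clim_seq_mult; [apply is_Clim_seq_const|].
      apply is_Clim_seq_RtoC, is_lim_seq_ln_succ.
    + apply is_Clim_seq_const.
Qed.

(** The quotient [(z+n+1)/(n z)] is written as [(1 + (z+1)/n) / z] to display its limit [1/z]. *)
Lemma Gamma_seq_step (z : C) (n : nat) : z <> 0 -> (0 < n)%nat -> rising (z + 1) (S n) <> 0 ->
  Gamma_seq z n = Gamma_seq (z + 1) n * (1 + (z + 1) * RtoC (/ INR n)) * / z.
Proof.
  intros Hz Hn Hr. unfold Gamma_seq. rewrite rising_S_l.
  change (rising (z + 1) (S n)) with (rising (z + 1) n * (z + 1 + INR n)) in *.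
  assert (Hn' : (0 < INR n)%R) by now apply lt_0_INR.
  replace ((z + 1) * RtoC (ln (INR n))) with (z * RtoC (ln (INR n)) + RtoC (ln (INR n))) by ring.
  rewrite Cexp_plus, Cexp_RtoC, exp_ln by easy.
  rewrite RtoC_inv by lra.
  assert (RtoC (INR n) <> 0) by (apply RtoC_neq_0; lra).
  assert (rising (z + 1) n <> 0) by (intro H'; apply Hr; rewrite H'; ring).
  assert (z + 1 + INR n <> 0) by (intro H'; apply Hr; rewrite H'; ring).
  field. auto.
Qed.

Lemma Gamma_converges_step (z : C) : z <> 0 ->
  Gamma_converges (z + 1) -> Gamma_converges z /\ Gamma z = Gamma (z + 1) / z.
Proof.
  intros Hz [Hk [H1 H2]].
  apply Gamma_converges_intro; [| | now apply Cdiv_neq_0].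
  { intros [|k]; [now rewrite Cplus_0_r |].
    rewrite S_INR, RtoC_plus. replace (z + (INR k + 1)) with (z + 1 + INR k) by ring. apply Hk. }
  apply is_Clim_seq_ext_loc with
    (fun n => Gamma_seq (z + 1) n * (1 + (z + 1) * RtoC (/ INR n)) * / z).
  - exists 1%nat. intros n Hn. symmetry. apply Gamma_seq_step; [easy | lia |].
    now apply rising_neq_0.
  - replace (Gamma (z + 1) / z) with (Gamma (z + 1) * (1 + (z + 1) * RtoC 0) * / z)
      by (unfold Cdiv; ring).
    apply is_Clim_seq_mult; [| apply is_Clim_seq_const].
    apply is_Clim_seq_mult; [easy|].
    apply is_Clim_seq_plus; [apply is_Clim_seq_const|].
    apply is_Clim_seq_mult; [apply is_Clim_seq_const|].
    apply is_Clim_seq_RtoC, is_lim_seq_inv_INR.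
Qed.

(** * Differentiation along horizontal lines *)

(** Derivative along the horizontal line through [z]: [C_lim], hence [C_derive],
    only looks at that direction. *)
Definition is_hderive (f : C -> C) (z d : C) : Prop :=
  is_derive (fun t => Re (f (t, Im z))) (Re z) (Re d) /\
  is_derive (fun t => Im (f (t, Im z))) (Re z) (Im d).

Lemma is_derive_Lim_quotient (f : R -> R) (x d : R) : is_derive f x d ->
  Lim (fun y => (f y - f x) / (y - x))%R x = d.
Proof.
  intro H. apply is_lim_unique, is_lim_spec. intro eps.
  apply is_derive_Reals in H.
  destruct (H eps (cond_pos eps)) as [delta Hd]. exists delta.
  intros y Hy Hne. specialize (Hd (y - x)%R).
  rewrite Rplus_minus in Hd.
  apply Hd; [now apply Rminus_eq_contra | exact Hy].
Qed.

(** On a horizontal line the increment of the argument is real, so the complex difference quotient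
    splits into two real ones. *)
Lemma is_hderive_C_derive (f : C -> C) (z d : C) : is_hderive f z d -> C_derive f z = d.
Proof.
  intros [H1 H2]. apply is_derive_Lim_quotient in H1, H2.
  rewrite (Cpair_decomp d), <- (f_equal real H1 : _ = Re d), <- (f_equal real H2 : _ = Im d).
  destruct z as [t y]. unfold C_derive, C_lim. cbn [fst snd Re Im].
  (* [Lim_ext] asks for equality at every point, including [x = t]; there the numerators vanish too,
     so both sides are 0 whatever the inverse of 0 is. *)
  assert (Hq : forall a b h : R, (h = 0 -> a = 0 /\ b = 0)%R ->
    (a, b) / ((h, 0%R) : C) = ((a / h)%R, (b / h)%R)).
  { intros a b h H. destruct (Req_dec h 0) as [E|E].
    - destruct (H E) as [-> ->]. unfold Cdiv, Cmult; simpl. f_equal; unfold Rdiv; ring.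
    - unfold Cdiv, Cmult, Cinv; simpl. f_equal; field; easy. }
  assert (E : forall x : R, (f (x, y) - f (t, y)) / ((x, y) - (t, y)) =
     (((Re (f (x, y)) - Re (f (t, y))) / (x - t))%R, ((Im (f (x, y)) - Im (f (t, y))) / (x - t))%R)).
  { intro x. rewrite <- Hq.
    - f_equal. unfold Cminus, Cplus, Copp; simpl. f_equal; ring.
    - intro Hx. replace x with t by lra. split; ring. }
  f_equal; f_equal; apply Lim_ext; intro x; now rewrite E.
Qed.

Lemma is_hderive_ext_loc (f g : C -> C) (z d : C) :
  locally (Re z) (fun t => f (t, Im z) = g (t, Im z)) -> is_hderive f z d -> is_hderive g z d.
Proof.
  intros H [H1 H2].
  split; (eapply is_derive_ext_loc; [| eassumption]); revert H; apply filter_imp;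
    intros t Ht; apply f_equal, Ht.
Qed.

Lemma is_hderive_mult (f g : C -> C) (z df dg : C) :
  is_hderive f z df -> is_hderive g z dg ->
  is_hderive (fun w => f w * g w) z (df * g z + f z * dg).
Proof.
  (* Occurrences 2 and 3 are the values [g z] and [f z], put in the shape that [P] produces. *)
  intros [H1 H2] [H3 H4]. rewrite (Cpair_decomp z) at 2 3.
  assert (P : forall (u v : R -> R) (du dv : R), is_derive u (Re z) du -> is_derive v (Re z) dv ->
    is_derive (fun t => u t * v t)%R (Re z) (du * v (Re z) + u (Re z) * dv)%R).
  { intros u v du dv Hu Hv. apply (is_derive_mult u v); trivial. intros; apply Rmult_comm. }
  split.
  - evar_last.
    + apply (is_derive_minus (K := R_AbsRing) (V := R_NormedModule)
        (fun t => Re (f (t, Im z)) * Re (g (t, Im z)))%R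
        (fun t => Im (f (t, Im z)) * Im (g (t, Im z)))%R); apply P; eassumption.
    + unfold minus, plus, opp, Cmult, Cplus, Re, Im; simpl. ring.
  - evar_last.
    + apply (is_derive_plus (K := R_AbsRing) (V := R_NormedModule)
        (fun t => Re (f (t, Im z)) * Im (g (t, Im z)))%R
        (fun t => Im (f (t, Im z)) * Re (g (t, Im z)))%R); apply P; eassumption.
    + unfold minus, plus, opp, Cmult, Cplus, Re, Im; simpl. ring.
Qed.

Lemma is_hderive_id (z : C) : is_hderive (fun w => w) z 1.
Proof. split; simpl; auto_derive; easy. Qed.

Lemma is_hderive_inv (z : C) : z <> 0 -> exists d, is_hderive Cinv z d.
Proof.
  intro Hz. destruct z as [t y].
  assert (Hn : (t ^ 2 + y ^ 2 <> 0)%R).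
  { intro H. apply Hz. unfold RtoC. f_equal; nra. }
  eexists (_, _). unfold Cinv. split; simpl; auto_derive; trivial.
Qed.

(** Adding 1 moves a point along its own horizontal line, so this is the real chain rule for a
    translation. *)
Lemma is_hderive_shift (f : C -> C) (z d : C) :
  is_hderive (fun w => f (w + 1)) z d <-> is_hderive f (z + 1) d.
Proof.
  assert (P : forall (u : R -> R) (t l : R),
    is_derive (fun x => u (x + 1)%R) t l <-> is_derive u (t + 1)%R l).
  { intros u t l. split; intro H.
    - apply (is_derive_ext (fun x => u (x - 1 + 1)%R)); [intro; f_equal; ring|].
      evar_last.
      + apply (is_derive_comp (fun x => u (x + 1)%R) (fun x => x - 1)%R).
        * replace (t + 1 - 1)%R with t by ring. eassumption.
        * auto_derive; [easy | reflexivity].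
      + unfold scal; simpl. unfold mult; simpl. ring.
    - evar_last.
      + apply (is_derive_comp u (fun x => x + 1)%R); [eassumption|].
        auto_derive; [easy | reflexivity].
      + unfold scal; simpl. unfold mult; simpl. ring. }
  assert (E : forall t : R, (t, Im z) + 1 = ((t + 1)%R, Im (z + 1))).
  { intro t. unfold Cplus, Im; simpl. f_equal. }
  assert (PR := P (fun t => Re (f (t, Im (z + 1)))) (Re z) (Re d)).
  assert (PI := P (fun t => Im (f (t, Im (z + 1)))) (Re z) (Im d)).
  split; intros [H1 H2]; split.
  - apply PR. eapply is_derive_ext; [| exact H1]. intro t; cbv beta; now rewrite E.
  - apply PI. eapply is_derive_ext; [| exact H2]. intro t; cbv beta; now rewrite E.
  - eapply is_derive_ext; [| apply PR, H1]. intro t; cbv beta; now rewrite E.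
  - eapply is_derive_ext; [| apply PI, H2]. intro t; cbv beta; now rewrite E.
Qed.

(** * Differentiability of Gamma off its poles *)

(** Convergence is required on a horizontal neighbourhood, because a formula for [Gamma] must hold
    around [z] before it can be differentiated at [z]. *)
Definition Gamma_regular (z : C) : Prop :=
  locally (Re z) (fun t => Gamma_converges (t, Im z)) /\ exists d, is_hderive Gamma z d.

Lemma is_hderive_Cexp (u v : R -> R) (z : C) :
  ex_derive u (Re z) -> ex_derive v (Re z) ->
  exists d, is_hderive (fun w => Cexp (u (Re w), v (Re w))) z d.
Proof.
  intros Hu Hv. eexists (_, _). unfold Cexp, is_hderive, Re, Im in *; cbn [fst snd] in *.
  split; auto_derive; try (split; [assumption | split; [assumption | easy]]); reflexivity.
Qed.

Lemma Gamma_regular_Re_pos (z : C) : (0 < Re z)%R -> Gamma_regular z.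
Proof.
  intro Hz.
  assert (L : locally (Re z) (fun t => 0 < t)%R) by now apply open_gt.
  split.
  - revert L. apply filter_imp. intros t Ht. now apply Gamma_Re_pos.
  - destruct (log_sums_derivable (Im z) (Re z) Hz) as [H1 H2].
    destruct (is_hderive_Cexp _ _ z H1 H2) as [d1 Hd1].
    destruct (is_hderive_inv z) as [d2 Hd2].
    { intros ->. simpl in Hz. lra. }
    eexists. eapply is_hderive_ext_loc; [| exact (is_hderive_mult _ _ _ _ _ Hd1 Hd2)].
    revert L. apply filter_imp. intros t Ht. symmetry.
    now apply (Gamma_Re_pos (t, Im z)).
Qed.

Lemma locally_Cpair_neq_0 (z : C) : z <> 0 -> locally (Re z) (fun t => (t, Im z) <> RtoC 0).
Proof.
  intro Hz. destruct (Req_dec (Im z) 0) as [E|E].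
  - assert (Hr : (Re z <> 0)%R).
    { intro H. apply Hz. rewrite (Cpair_decomp z), E, H. reflexivity. }
    assert (L : locally (Re z) (fun t => t <> 0%R)) by now apply open_neq.
    revert L. apply filter_imp. intros t Ht H. apply Ht. now injection H.
  - apply filter_forall. intros t H. apply E. now injection H.
Qed.

(** Around [z] one has [Gamma w = Gamma (w + 1) / w], a product of two functions differentiable at
    [z]. *)
Lemma Gamma_regular_step (z : C) : z <> 0 -> Gamma_regular (z + 1) -> Gamma_regular z.
Proof.
  intros Hz [HL [d Hd]].
  assert (L : locally (Re z) (fun t => Gamma_converges ((t, Im z) + 1) /\ (t, Im z) <> RtoC 0)).
  { apply filter_and; [| now apply locally_Cpair_neq_0].
    destruct HL as [eps Heps]. exists eps. intros t Ht.
    replace ((t, Im z) + 1) with ((t + 1)%R, Im (z + 1)).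
    - apply Heps. revert Ht. unfold ball; simpl. unfold AbsRing_ball, abs, minus, plus, opp; simpl.
      destruct z; simpl. now replace (t + 1 + - (r + 1))%R with (t + - r)%R by ring.
    - destruct z. unfold Cplus; simpl. now f_equal. }
  split.
  - revert L. apply filter_imp. intros t [H1 H2]. now apply Gamma_converges_step.
  - apply is_hderive_shift in Hd. destruct (is_hderive_inv z Hz) as [d2 Hd2].
    eexists. eapply is_hderive_ext_loc; [| exact (is_hderive_mult _ _ _ _ _ Hd Hd2)].
    revert L. apply filter_imp. intros t [H1 H2]. symmetry. now apply Gamma_converges_step.
Qed.

Lemma Gamma_regular_all (z : C) : (forall k, z + INR k <> 0) -> Gamma_regular z.
Proof.
  destruct (INR_unbounded (- Re z)) as [N HN].
  (* Induction on a natural number exceeding [- Re z], for all [z] at once: the step passes to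
     [z + 1], for which one unit less is enough. *)
  revert z HN. induction N as [|N IH]; intros z HN Hk.
  - apply Gamma_regular_Re_pos. simpl in HN. lra.
  - apply Gamma_regular_step.
    + intros ->. apply (Hk O). simpl. ring.
    + apply IH.
      * rewrite S_INR in HN. destruct z; simpl in *. lra.
      * intros k H. apply (Hk (S k)). rewrite S_INR, RtoC_plus, <- H. ring.
Qed.

Lemma Gamma_regular_converges (z : C) : Gamma_regular z -> Gamma_converges z.
Proof. intros [H _]. apply locally_singleton in H. now rewrite (Cpair_decomp z). Qed.

Lemma Gamma_neq_0 (z : C) : (forall k, z + INR k <> 0) -> Gamma z <> 0.
Proof. intro H. now apply Gamma_regular_converges, Gamma_regular_all. Qed.

(** * Recurrences for Gamma, digamma, harmonic numbers and binomials *)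

Lemma nonpole_succ (z : C) : (forall k, z + INR k <> 0) -> forall k, z + 1 + INR k <> 0.
Proof.
  intros Hk k H. apply (Hk (S k)). rewrite S_INR, RtoC_plus, <- H. ring.
Qed.

Lemma nonpole_neq_0 (z : C) : (forall k, z + INR k <> 0) -> z <> 0.
Proof. intros Hk ->. apply (Hk O). simpl. ring. Qed.

Lemma Gamma_succ (z : C) : (forall k, z + INR k <> 0) -> Gamma (z + 1) = z * Gamma z.
Proof.
  intro Hk. assert (Hz := nonpole_neq_0 z Hk).
  assert (H : Gamma_converges (z + 1)) by now apply Gamma_regular_converges, Gamma_regular_all, nonpole_succ.
  rewrite (proj2 (Gamma_converges_step z Hz H)). field. easy.
Qed.

(** Logarithmic derivative of [Gamma (w + 1) = w * Gamma w], an equation valid near [z] on its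
    horizontal line. *)
Lemma digamma_succ (z : C) : (forall k, z + INR k <> 0) -> digamma (z + 1) = digamma z + 1 / z.
Proof.
  intro Hk. assert (Hz := nonpole_neq_0 z Hk). assert (HG := Gamma_neq_0 z Hk).
  destruct (Gamma_regular_all z Hk) as [L [d Hd]].
  assert (H1 : is_hderive Gamma (z + 1) (1 * Gamma z + z * d)).
  { apply (proj1 (is_hderive_shift Gamma z _)).
    apply (is_hderive_ext_loc (fun w => w * Gamma w)).
    2: exact (is_hderive_mult _ _ _ _ _ (is_hderive_id z) Hd).
    revert L. apply filter_imp. intros t [Ht _]. symmetry. now apply Gamma_succ. }
  unfold digamma. rewrite (is_hderive_C_derive _ _ _ H1), (is_hderive_C_derive _ _ _ Hd).
  rewrite Gamma_succ by easy. field. auto.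
Qed.

Lemma nonpole_INR_succ (n : nat) : forall k, RtoC (INR n) + 1 + INR k <> 0.
Proof.
  intros k. rewrite <- !RtoC_plus. apply RtoC_neq_0.
  pose proof (pos_INR n). pose proof (pos_INR k). lra.
Qed.

Lemma nonpole_plus_INR (z : C) (n : nat) :
  (forall k, z + INR k <> 0) -> forall k, z + INR n + INR k <> 0.
Proof.
  intros Hz k. rewrite <- Cplus_assoc, <- RtoC_plus, <- plus_INR. apply Hz.
Qed.

Lemma harmonic_succ (z : C) : (forall k, z + 1 + INR k <> 0) ->
  harmonic (z + 1) = harmonic z + 1 / (z + 1).
Proof.
  intro Hk. unfold harmonic. rewrite digamma_succ by easy. ring.
Qed.

Lemma Cbinom_ratio_O (m : C) : (forall k, m + 1 + INR k <> 0) ->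
  Cbinom (m + INR 0) (INR 0) / Cbinom (2 * INR 0) (INR 0) = 1.
Proof.
  intro Hm. unfold Cbinom. simpl INR.
  replace (m + 0 - 0 + 1) with (m + 1) by ring. replace (m + 0 + 1) with (m + 1) by ring.
  replace (2 * 0 - 0 + 1) with (RtoC 0 + 1) by ring.
  replace (2 * 0 + 1) with (RtoC 0 + 1) by ring.
  assert (Gamma (m + 1) <> 0) by now apply Gamma_neq_0.
  assert (Gamma (0 + 1) <> 0) by exact (Gamma_neq_0 _ (nonpole_INR_succ O)).
  field. auto.
Qed.

(** The upper binomial gains [(m+n+1)/(n+1)], the central one
    [(2n+2)(2n+1)/(n+1)^2 = 2(2n+1)/(n+1)]; the factor [n+1] cancels in the quotient. *)
Lemma Cbinom_ratio_S (m : C) (n : nat) : (forall k, m + 1 + INR k <> 0) ->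
  Cbinom (m + INR (S n)) (INR (S n)) / Cbinom (2 * INR (S n)) (INR (S n)) =
  (m + INR n + 1) / (2 * (2 * INR n + 1)) *
  (Cbinom (m + INR n) (INR n) / Cbinom (2 * INR n) (INR n)).
Proof.
  intro Hm. unfold Cbinom.
  assert (H1 : forall k, m + INR n + 1 + INR k <> 0).
  { intro k. pose proof (nonpole_plus_INR _ n Hm k) as H.
    now replace (m + INR n + 1 + INR k) with (m + 1 + INR n + INR k) by ring. }
  pose proof (nonpole_INR_succ n) as H2.
  assert (H3 : forall k, 2 * INR n + 1 + INR k <> 0).
  { intro k. pose proof (nonpole_INR_succ (2 * n) k) as H. now rewrite mult_INR, RtoC_mult in H. }
  rewrite S_INR, RtoC_plus.
  replace (m + (INR n + 1) - (INR n + 1) + 1) with (m + 1) by ring.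
  replace (m + INR n - INR n + 1) with (m + 1) by ring.
  replace (2 * (INR n + 1) - (INR n + 1) + 1) with (INR n + 1 + 1) by ring.
  replace (2 * INR n - INR n + 1) with (INR n + 1) by ring.
  replace (m + (INR n + 1) + 1) with (m + INR n + 1 + 1) by ring.
  replace (2 * (INR n + 1) + 1) with (2 * INR n + 1 + 1 + 1) by ring.
  rewrite (Gamma_succ _ (nonpole_succ _ H3)), (Gamma_succ _ H3), (Gamma_succ _ H2), (Gamma_succ _ H1).
  pose proof (Gamma_neq_0 _ H1). pose proof (Gamma_neq_0 _ H2). pose proof (Gamma_neq_0 _ H3).
  pose proof (Gamma_neq_0 _ Hm).
  pose proof (nonpole_neq_0 _ H2). pose proof (nonpole_neq_0 _ H3).
  pose proof (nonpole_neq_0 _ (nonpole_succ _ H3)).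
  field. repeat split; trivial.
Qed.

(** * The summation identity, by induction on the upper limit *)

Theorem theorem2p1 (n : nat) (m : C)
  (hm : forall j : Z, (j < 0)%Z -> m <> RtoC (IZR j))
  (hm32 : m <> - (3 / 2)) :
  @sum_n C_AbelianMonoid
    (fun k : nat =>
       2 ^ (2 * k) * (Cbinom (m + INR k) (INR k) / Cbinom (2 * INR k) (INR k))
       * harmonic (INR k + m)) n
  = 1 / (2 * m + 3)
      * (2 ^ (2 * n + 1) * (m + INR n + 1)
           * (Cbinom (m + INR n) (INR n) / Cbinom (2 * INR n) (INR n))
           * harmonic (INR n + m)
         + harmonic m)
    - 2 / (2 * m + 3) ^ 2
      * (2 ^ (2 * n) * (2 * INR n - 1)
           * (Cbinom (m + INR n) (INR n) / Cbinom (2 * INR n) (INR n))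
         + 1).
Proof.
  assert (Hd : 2 * m + 3 <> 0).
  { intro H. apply hm32. replace m with ((2 * m + 3 - 3) / 2) by field.
    rewrite H. field. }
  (* That [m] is no negative integer means that [m + 1] is not a pole of [Gamma]. *)
  assert (Hk : forall k, m + 1 + INR k <> 0).
  { intros k H. apply (hm (- Z.of_nat (S k))%Z); [lia|].
    rewrite opp_IZR, <- INR_IZR_INZ, S_INR, RtoC_opp, RtoC_plus.
    replace m with (m + 1 + INR k - 1 - INR k) by ring. rewrite H. ring. }
  induction n as [|n IH].
  (* Both sides are [harmonic m]: [2 (m+1) + 1 = 2m + 3], and the second bracket is [-1 + 1]. *)
  - rewrite sum_O, Cbinom_ratio_O by easy. simpl. rewrite Cplus_0_l. field. easy.
  - rewrite sum_Sn, IH, Cbinom_ratio_S by easy.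
    set (b := _ / Cbinom _ _).
    replace (2 * S n + 1)%nat with (S (S (2 * n + 1))) by lia.
    replace (2 * S n)%nat with (S (S (2 * n))) by lia.
    replace (2 * n + 1)%nat with (S (2 * n)) by lia.
    rewrite !Cpow_S, S_INR, RtoC_plus.
    replace (INR n + 1 + m) with (INR n + m + 1) by ring.
    assert (H1 : INR n + m + 1 <> 0).
    { intro H. apply (Hk n). rewrite <- H. ring. }
    rewrite harmonic_succ.
    2: { intro k. pose proof (nonpole_plus_INR _ n Hk k) as H.
         now replace (INR n + m + 1 + INR k) with (m + 1 + INR n + INR k) by ring. }
    assert (H3 : 2 * INR n + 1 <> 0).
    { rewrite <- RtoC_mult, <- RtoC_plus. apply RtoC_neq_0. pose proof (pos_INR n). lra. }
    change (@plus C_AbelianMonoid) with Cplus.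
    match goal with |- ?l = ?r => change (@eq C l r) end.
    (* What remains is a rational identity in [m], [INR n], [w], [b], [h] and [harmonic m]; the
       coefficients of [h] agree because [(2n+1) + (2m+3) = 2 (m+n+2)]. *)
    generalize (2 ^ (2 * n)), (harmonic (INR n + m)). intros w h.
    field. auto.
Qed.
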